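(* Let $A_2=\mathbb{Z}\alpha\oplus\mathbb{Z}\beta$ be the root lattice of type $A_2$, with $(\alpha|\alpha)=(\beta|\beta)=2$ and $(\alpha|\beta)=-1$, and let $B=\{m\alpha+n\beta: m,n\in\mathbb{Z},\ n>0\}+\mathbb{Z}_{\ge0}\alpha$, understood as the Borel-type submonoid $\{m\alpha+n\beta:m,n\in\mathbb{Z},\ n>0\}\cup\mathbb{Z}_{\ge0}\alpha$ of $A_2$. Then the subVOA $V_B$ of $V_{A_2}$ is not $C_1$-cofinite.
   Context: Lattice VOA. For a positive-definite even lattice $L$ put $\mathfrak{h}=\mathbb{C}\otimes_{\mathbb{Z}}L$ with the $\mathbb{C}$-bilinear extension of $(\cdot|\cdot)$, and $\hat{\mathfrak{h}}=\mathfrak{h}\otimes\mathbb{C}[t,t^{-1}]\oplus\mathbb{C}K$ with $K$ central, $h(m)=h\otimes t^m$, $[h_1(m),h_2(n)]=m\delta_{m+n,0}(h_1|h_2)K$. For $\lambda\in\mathfrak{h}$, $M_{\hat{\mathfrak{h}}}(1,\lambda)=U(\hat{\mathfrak{h}})\otimes_{U(\hat{\mathfrak{h}}_{\ge 0})}\mathbb{C}e^\lambda$, where $\hat{\mathfrak{h}}_{\ge 0}=\mathfrak{h}\otimes\mathbb{C}[t]\oplus\mathbb{C}K$ acts by $K=1$, $h(0)e^\lambda=(h|\lambda)e^\lambda$, $h(n)e^\lambda=0$ for $n>0$. Let $\epsilon:L\times L\to\{\pm1\}$ be a 2-cocycle with $\epsilon(\alpha,\beta)\epsilon(\beta,\alpha)=(-1)^{(\alpha|\beta)}$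 and $\epsilon(0,\alpha)=\epsilon(\alpha,0)=1$. The lattice VOA is $V_L=\bigoplus_{\alpha\in L}M_{\hat{\mathfrak{h}}}(1,\alpha)=M_{\hat{\mathfrak{h}}}(1,0)\otimes\mathbb{C}^\epsilon[L]$ with vacuum $\mathbf{1}=e^0$, $Y(h(-1)\mathbf{1},z)=\sum_{n}h(n)z^{-n-1}$, $Y(e^\alpha,z)=\exp\big(\sum_{n>0}\frac{\alpha(-n)}{n}z^n\big)\exp\big(-\sum_{n>0}\frac{\alpha(n)}{n}z^{-n}\big)e_\alpha z^\alpha$, where $e_\alpha(w\otimes e^\beta)=\epsilon(\alpha,\beta)w\otimes e^{\alpha+\beta}$ and $z^\alpha$ acts on $M_{\hat{\mathfrak{h}}}(1,\beta)$ as $z^{(\alpha|\beta)}$; $Y$ of a general $h_1(-n_1-1)\cdots h_k(-n_k-1)e^\alpha$ is the normally ordered product of the $\frac{1}{n_i!}\partial_z^{n_i}h_i(z)$ and $Y(e^\alpha,z)$. The Virasoro element is $\omega=\frac12\sum_i u_i(-1)^2\mathbf{1}$ for an orthonormal basis $\{u_i\}$ of $\mathfrak{h}$; the weight of $h_1(-n_1)\cdots h_k(-n_k)e^\alpha$ is $n_1+\cdots+n_k+(\alpha|\alpha)/2$. For a submonoid $M\le L$ (a subset containing $0$ and closed under addition), $V_M=\bigoplus_{\gamma\in M}M_{\hat{\mathfrak{h}}}(1,\gamma)$ is a subVOA of $V_L$ with the same vacuum and Virasoro element. A submonoid $B\le L$ is of Borel-type if $B\cup(-B)=L$, $B\cap(-B)=\{0\}$,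 and $B$ lies in a closed half-space $\{v:(\gamma|v)\ge0\}$, $\gamma\ne0$. For a CFT-type VOA $V=\mathbb{C}\mathbf{1}\oplus V_+$, $V_+=\bigoplus_{n\ge1}V_n$, with $Y(a,z)=\sum_n a_nz^{-n-1}$, $C_1(V)=\mathrm{span}\{a_{-1}b:a,b\in V_+\}+\mathrm{span}\{L(-1)v:v\in V_+\}$, and $V$ is $C_1$-cofinite if $\dim V/C_1(V)<\infty$. *)

(* Defs.v *)
From HB Require Import structures.
From mathcomp Require Import all_boot all_order all_algebra.
From mathcomp Require Import finmap multiset complex.
From mathcomp Require Import boolp classical_sets functions cardinality fsbigop reals.
From mathcomp Require Import monalg.

Set Implicit Arguments.
Unset Strict Implicit.
Unset Printing Implicit Defensive.

Import Order.TTheory GRing.Theory Num.Theory.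

Local Open Scope classical_set_scope.
Local Open Scope ring_scope.

(* ------------------------------------------------------------------------ *)
(* C_1-cofiniteness                                                         *)
(* ------------------------------------------------------------------------ *)

Section LinearSpan.
Context {K : fieldType} {V : lmodType K}.

Definition lspan (S : set V) : set V :=
  [set v | exists (n : nat) (c : 'I_n -> K) (x : 'I_n -> V),
     (forall i, S (x i)) /\ v = \sum_(i < n) c i *: x i].

(* dim (U / S) < oo for subspaces S <= U: finitely many classes span U / S. *)
Definition finite_codim (U S : set V) : Prop :=
  exists s : seq V, (forall x, x \in s -> U x) /\
    forall v, U v -> exists2 c, S c & lspan [set x | x \in s] (v - c).

End LinearSpan.

(* The operations of a VOA, without its axioms.  [vmode a n] is a_n in
   Y(a,z) = \sum_n a_n z^{-n-1}; [vweight n] is the homogeneous subspace of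
   weight n. *)
Record voaData (K : fieldType) := VoaData {
  vspc :> lmodType K;
  vvac : vspc;
  vmode : vspc -> int -> vspc -> vspc;
  vomega : vspc;
  vweight : int -> set vspc
}.

Section C1.
Context {K : fieldType} {V : voaData K}.

Definition virL (n : int) : V -> V := vmode (vomega V) (n + 1).

(* W stands for a graded subVOA with the same vacuum and Virasoro element,
   so that its modes a_n and L(n) are those of V. *)
Variable W : set V.

Definition is_subVOA : Prop :=
  [/\ W (vvac V), W (vomega V),
      forall (c : K) (a b : V), W a -> W b -> W (c *: a + b) &
      forall (a b : V) (n : int), W a -> W b -> W (vmode a n b)].

Definition Vplus : set V :=
  lspan [set v | W v /\ exists2 n : int, 1 <= n & @vweight K V n v].

Definition C1space : set V :=
  [set x + y | x in lspan [set v | exists a b : V,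
                             [/\ Vplus a, Vplus b & v = vmode a (- 1) b]]
             & y in lspan [set virL (- 1) v | v in Vplus]].

Definition C1_cofinite : Prop := finite_codim W C1space.

End C1.
Arguments is_subVOA {K} V W.
Arguments Vplus {K} V W.
Arguments C1space {K} V W.
Arguments C1_cofinite {K} V W.

(* ------------------------------------------------------------------------ *)
(* Even lattices, in the coordinates of a Z-basis: L = Z^r, Gram matrix G   *)
(* ------------------------------------------------------------------------ *)

Section Lattice.
Context {r : nat} (G : 'M[int]_r).
Local Notation L := 'rV[int]_r.

Definition lform (x y : L) : int := (x *m G *m y^T) 0 0.

(* the bilinear extension to A (x)_Z L *)
Definition hform {A : comPzRingType} (x y : 'rV[A]_r) : A :=
  (x *m map_mx intr G *m y^T) 0 0.

Definition lemb {A : comPzRingType} (x : L) : 'rV[A]_r := map_mx intr x.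

Definition pos_def_even : Prop :=
  [/\ G^T = G, forall x : L, (2 %| lform x x)%Z &
      forall x : L, x != 0 -> 0 < lform x x].

Definition is_cocycle (eps : L -> L -> int) : Prop :=
  [/\ forall a b, eps a b = 1 \/ eps a b = - 1,
      forall a b c, eps a b * eps (a + b) c = eps b c * eps a (b + c),
      forall a b, eps a b * eps b a = (- 1) ^ lform a b &
      forall a, eps 0 a = 1 /\ eps a 0 = 1].

Definition is_submonoid (M : set L) : Prop :=
  M 0 /\ forall a b, M a -> M b -> M (a + b).

Definition borel_type (R : realType) (B : set L) : Prop :=
  [/\ is_submonoid B, B `|` [set - x | x in B] = setT,
      B `&` [set - x | x in B] = [set 0] &
      exists2 g : 'rV[R]_r, g != 0 &
        forall x, B x -> 0 <= hform g (lemb x)].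

(* u i, for i < r, is an orthonormal basis of K (x)_Z L *)
Definition orthonormal_basis {K : fieldType} (u : 'I_r -> 'rV[K]_r) : Prop :=
  forall i j, hform (u i) (u j) = (i == j)%:R.

End Lattice.

(* ------------------------------------------------------------------------ *)
(* Formal series of operators                                               *)
(* ------------------------------------------------------------------------ *)

Section Fields.
Context {K : fieldType} {V : lmodType K}.

(* Power series in one variable with coefficients in End V. *)
Definition opser := nat -> V -> V.

Definition opser_one : opser := fun n v => if n == 0%N then v else 0.
Definition opser_mul (A B : opser) : opser :=
  fun n v => \sum_(i < n.+1) A i (B (n - i)%N v).

(* exp A for A without constant term: A^k only has terms of degree >= k. *)
Definition opser_exp (A : opser) : opser :=
  fun n v => \sum_(k < n.+1) (k`!)%:R^-1 *: iter k (opser_mul A) opser_one n v.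

(* Fields A(z) = \sum_(n : int) A_n z^{-n-1}, given by the family (A_n). *)
Definition field := int -> V -> V.

Definition fderiv (A : field) : field := fun n v => (- n)%:~R *: A (n - 1) v.

Definition fdivderiv (k : nat) (A : field) : field :=
  fun n v => (k`!)%:R^-1 *: iter k fderiv A n v.

(* :A(z)B(z): = A_-(z) B(z) + B(z) A_+(z), where A_+ collects the A_j with
   j >= 0 and A_- the A_j with j < 0; recall Negz j = - (j + 1).  The sums
   are sums over the (finite) support of the family. *)
Definition nop (A B : field) : field := fun n v =>
  \sum_(j \in [set: nat]) A (Negz j) (B (n + j%:Z) v) +
  \sum_(j \in [set: nat]) B (n - j%:Z - 1) (A j%:Z v).

End Fields.

(* ------------------------------------------------------------------------ *)
(* The lattice VOA                                                          *)
(* ------------------------------------------------------------------------ *)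

(* By PBW, V_L has the basis of all \prod_k alpha_{i_k}(-n_k-1) e^gamma,
   where (alpha_i)_{i < r} is the chosen basis of L and gamma runs over L;
   such an element is indexed by the multiset of the pairs (i_k, n_k)
   together with gamma. *)
Definition pbw (r : nat) : choiceType :=
  ({mset ('I_r * nat)%type}%mset * 'rV[int]_r)%type.

Definition latV (K : fieldType) (r : nat) : Type := {malg K[pbw r]}.
HB.instance Definition _ K r := Choice.on (latV K r).

(* The module structure of {malg K[pbw r]}, with sealed operations: conversion
   would otherwise unfold them down to finitely supported functions. *)
HB.lock Definition lat0 (K : fieldType) (r : nat) : latV K r := 0 : {malg K[pbw r]}.
HB.lock Definition lat_opp (K : fieldType) (r : nat) (v : latV K r) : latV K r :=
  - (v : {malg K[pbw r]}).
HB.lock Definition lat_add (K : fieldType) (r : nat) (v w : latV K r) : latV K r :=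
  (v : {malg K[pbw r]}) + w.
HB.lock Definition lat_scale (K : fieldType) (r : nat) (c : K) (v : latV K r) : latV K r :=
  c *: (v : {malg K[pbw r]}).

Section LatModule.
Context {K : fieldType} {r : nat}.

Fact lat_addA : associative (@lat_add K r).
Proof. by move=> u v w; rewrite lat_add.unlock addrA. Qed.
Fact lat_addC : commutative (@lat_add K r).
Proof. by move=> u v; rewrite lat_add.unlock addrC. Qed.
Fact lat_add0 : left_id (@lat0 K r) (@lat_add K r).
Proof. by move=> u; rewrite lat_add.unlock lat0.unlock add0r. Qed.
Fact lat_addN : left_inverse (@lat0 K r) (@lat_opp K r) (@lat_add K r).
Proof.
by move=> u; rewrite lat_add.unlock lat_opp.unlock lat0.unlock addNr.
Qed.
HB.instance Definition _ := GRing.isZmodule.Build (latV K r)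
  lat_addA lat_addC lat_add0 lat_addN.

Fact lat_scaleA (a b : K) (v : latV K r) :
  lat_scale a (lat_scale b v) = lat_scale (a * b) v.
Proof. by rewrite lat_scale.unlock scalerA. Qed.
Fact lat_scale1 : left_id 1 (@lat_scale K r).
Proof. by move=> v; rewrite lat_scale.unlock scale1r. Qed.
Fact lat_scaleDr : right_distributive (@lat_scale K r) +%R.
Proof.
move=> a u v; rewrite /GRing.add /= lat_scale.unlock lat_add.unlock.
by rewrite scalerDr.
Qed.
Fact lat_scaleDl (v : latV K r) : {morph (@lat_scale K r)^~ v : a b / a + b}.
Proof.
move=> a b; rewrite [RHS]/GRing.add /= lat_scale.unlock lat_add.unlock.
by rewrite scalerDl.
Qed.
HB.instance Definition _ := GRing.Zmodule_isLmodule.Build K (latV K r)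
  lat_scaleA lat_scale1 lat_scaleDr lat_scaleDl.

End LatModule.

HB.lock Definition bvec {K : fieldType} {r : nat} (k : pbw r) : latV K r :=
  << k >>.

HB.lock Definition lext {K : fieldType} {r : nat} {W : lmodType K}
    (f : pbw r -> W) (v : latV K r) : W := \sum_(k <- msupp v) v@_k *: f k.

Section LatticeVOA.
Context {K : fieldType} {r : nat} (G : 'M[int]_r).
Variable eps : 'rV[int]_r -> 'rV[int]_r -> int.
Local Notation L := 'rV[int]_r.
Local Notation h := 'rV[K]_r.

Local Notation pbw := (pbw r).
Local Notation latV := (latV K r).

Definition expv (g : L) : latV := bvec (mset0%mset, g).

Definition basis_h {A : comPzRingType} (i : 'I_r) : 'rV[A]_r := delta_mx 0 i.

(* On M(1,gamma) = Sym(h (x) t^{-1}K[t^{-1}]) e^gamma the operator h(-n-1)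
   is multiplication, h(0) is the scalar (h|gamma), and h(n+1) is the
   derivation with alpha_j(-n-1) |-> (n+1)(h|alpha_j) killing e^gamma. *)
Definition heis (x : h) (m : int) : latV -> latV :=
  match m with
  | Posz 0 => lext (fun k => hform G x (lemb k.2) *: bvec k)
  | Posz n.+1 => lext (fun k => \sum_(j < r)
      (n.+1%:R * hform G x (basis_h j) * (k.1 (j, n))%:R) *:
        bvec (k.1 `\ (j, n), k.2)%mset)
  | Negz n => lext (fun k => \sum_(i < r)
      x 0 i *: bvec ((i, n) +` k.1, k.2)%mset)
  end.

(* exp (\sum_{n>0} a(-n)/n z^n), a power series in z *)
Definition exp_creat (a : L) : opser :=
  opser_exp (fun n v => if n == 0%N then 0
                        else n%:R^-1 *: heis (lemb a) (- n%:Z) v).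

(* exp (- \sum_{n>0} a(n)/n z^{-n}), a power series in z^{-1} *)
Definition exp_annih (a : L) : opser :=
  opser_exp (fun n v => if n == 0%N then 0
                        else - (n%:R^-1 *: heis (lemb a) n%:Z v)).

(* coefficient of z^d in e_a z^a *)
Definition shift_z (a : L) (d : int) : latV -> latV :=
  lext (fun k => if lform G a k.2 == d
                 then (eps a k.2)%:~R *: bvec (k.1, a + k.2) else 0).

(* Y(e^a,z); the coefficient of z^{-n-1} collects z^p z^{-q} z^d with
   p - q + d = - n - 1. *)
Definition Yexp (a : L) : field := fun n v =>
  \sum_(pq \in [set: (nat * nat)%type])
    exp_creat a pq.1 (exp_annih a pq.2
      (shift_z a (- n - 1 - pq.1%:Z + pq.2%:Z) v)).

Definition Ybasis (k : pbw) : field :=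
  foldr (fun x F => nop (fdivderiv x.2 (heis (basis_h x.1))) F)
        (Yexp k.2) (enum_mset k.1).

Definition latY (a : latV) (n : int) (b : latV) : latV :=
  lext (fun k => Ybasis k n b) a.

(* (gamma|gamma) is even, so the division by 2 is exact. *)
Definition wt_pbw (k : pbw) : int :=
  (\sum_(x <- enum_mset k.1) x.2.+1)%N%:Z + (lform G k.2 k.2 %/ 2)%Z.

Definition latweight (n : int) : set latV :=
  [set v | forall k, k \in msupp v -> wt_pbw k = n].

Definition lat_omega (u : 'I_r -> h) : latV :=
  2%:R^-1 *: \sum_(i < r) heis (u i) (- 1) (heis (u i) (- 1) (expv 0)).

Definition latticeVOA (u : 'I_r -> h) : voaData K :=
  {| vspc := latV; vvac := expv 0; vmode := latY;
     vomega := lat_omega u; vweight := latweight |}.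

(* V_M = \bigoplus_(gamma in M) M(1,gamma) *)
Definition latsub (M : set L) : set latV :=
  [set v | forall k, k \in msupp v -> M k.2].

End LatticeVOA.

(* ------------------------------------------------------------------------ *)
(* The lattice A_2 and the submonoid B                                      *)
(* ------------------------------------------------------------------------ *)

Definition A2_gram : 'M[int]_2 :=
  \matrix_(i, j) (if i == j then 2 else - 1).

Definition A2_alpha : 'rV[int]_2 := delta_mx 0 0.
Definition A2_beta : 'rV[int]_2 := delta_mx 0 1.

Definition A2_B : set 'rV[int]_2 :=
  [set x | exists m n : int, 0 < n /\ x = A2_alpha *~ m + A2_beta *~ n] `|`
  [set x | exists k : nat, x = A2_alpha *+ k].

(* Main.v *)
Require Import Defs.
From mathcomp Require Import all_boot all_order all_algebra.
From mathcomp Require Import complex reals.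
From mathcomp Require Import finmap multiset boolp classical_sets fsbigop monalg.
From mathcomp Require Import zify ring.

(** Why V_B is not C_1-cofinite.  The VOA V_L is graded by the conformal weight
    and by the charge gamma in L, and every mode is homogeneous for both: if a
    and b have weights p and q and charges gamma and delta, then a_{-1} b has
    weight p + q and charge gamma + delta, and L(-1) b has weight q + 1 and
    charge delta.  So the bidegrees occurring in C_1(V_B) come from pairs of
    bidegrees of V_B of positive weight, or from a shift of the weight by one
    ([C1_bideg]).

    Take the lowest weight vector e^gamma with gamma = - m alpha + beta, m >= 0;
    its weight is m^2 + m + 1.  A decomposition of gamma in B is
    gamma = k alpha + (-(m + k) alpha + beta) with k >= 0.  An element of V_+
    has weight at least 1, and M(1, gamma - k alpha) starts in weight
    (m + k)^2 + (m + k) + 1 >= m^2 + m + 1.  So if one of a, b in V_+ has charge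
    k alpha and the other gamma - k alpha, then a_{-1} b lies strictly above
    e^gamma, and so does L(-1) v for v in M(1, gamma).  Hence no
    e^gamma of this form occurs in an element of C_1(V_B)
    ([A2_B_indecomposable]), and infinitely many of them cannot be spanned
    modulo C_1(V_B) by finitely many vectors ([infinite_codim]).

    The grading is handled through supports on the PBW basis.  An operator is
    called homogeneous when it moves supports by a fixed bidegree; this notion
    passes to sums and composites without any linearity, so it also passes to
    the infinite sums in the normally ordered products. *)

Set Implicit Arguments.
Unset Strict Implicit.
Unset Printing Implicit Defensive.

Import Order.TTheory GRing.Theory Num.Theory.

Local Open Scope classical_set_scope.
Local Open Scope ring_scope.

(** * Supports on the PBW basis *)

Section Support.
Context {K : fieldType} {r : nat}.
Implicit Types (v w : latV K r) (P Q : set (pbw r)).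

Definition supp_in P v : Prop := forall k, k \in msupp v -> P k.

Lemma supp_in0 P : supp_in P 0.
Proof. by move=> k; rewrite /GRing.zero /= lat0.unlock msupp0 in_fset0. Qed.

Lemma supp_inD P v w : supp_in P v -> supp_in P w -> supp_in P (v + w).
Proof.
move=> Pv Pw k; rewrite /GRing.add /= lat_add.unlock.
by move=> /(fsubsetP (msuppD_le _ _)); rewrite in_fsetU => /orP[/Pv|/Pw].
Qed.

Lemma supp_inZ P c v : supp_in P v -> supp_in P (c *: v).
Proof.
move=> Pv k; rewrite /GRing.scale /= lat_scale.unlock.
by move=> /(fsubsetP (msuppZ_le _ _)) /Pv.
Qed.

Lemma supp_in_sum P I (s : seq I) (p : pred I) (F : I -> latV K r) :
  (forall i, p i -> supp_in P (F i)) -> supp_in P (\sum_(i <- s | p i) F i).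
Proof. exact: (big_ind _ (supp_in0 P) (@supp_inD P)). Qed.

Lemma msupp_bvec (k : pbw r) : msupp (bvec k : latV K r) = [fset k]%fset.
Proof. by rewrite bvec.unlock msuppU oner_eq0. Qed.

Lemma supp_in_bvec P k : P k -> supp_in P (bvec k).
Proof. by move=> Pk k'; rewrite msupp_bvec in_fset1 => /eqP->. Qed.

Lemma supp_in_lext P Q (f : pbw r -> latV K r) v :
  supp_in P v -> (forall k, P k -> supp_in Q (f k)) -> supp_in Q (lext f v).
Proof.
move=> Pv fQ; rewrite lext.unlock big_seq.
by apply: supp_in_sum => k /Pv /fQ; apply: supp_inZ.
Qed.

Lemma supp_in_lspan P (S : set (latV K r)) v :
  (forall w, S w -> supp_in P w) -> lspan S v -> supp_in P v.
Proof.
move=> SP [n [c [x [Sx ->]]]]; apply: supp_in_sum => i _.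
by apply: supp_inZ; apply: SP.
Qed.

(** Finitely many vectors involve finitely many basis vectors, so infinitely
    many basis vectors that no element of [S] involves have infinite span
    modulo [S]. *)
Lemma infinite_codim (U S : set (latV K r)) (e : nat -> pbw r) :
  injective e -> (forall m, U (bvec (e m))) ->
  (forall v m, S v -> e m \notin msupp v) -> ~ finite_codim U S.
Proof.
move=> e_inj Ue Se [s [_ sP]].
pose ks := flatten [seq enum_fset (msupp (x : {malg K[pbw r]})) | x <- s].
have [m em] : exists m, e m \notin ks.
  apply: contrapT => /forallNP ks_e.
  have le_sz : (size (map e (iota 0 (size ks).+1)) <= size ks)%N.
    apply: uniq_leq_size; first by rewrite map_inj_uniq ?iota_uniq.
    by move=> _ /mapP[m _ ->]; apply/negPn/negP/ks_e.
  by rewrite size_map size_iota ltnn in le_sz.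
have [c Sc span_c] := sP _ (Ue m).
have : supp_in [set k | k != e m] (bvec (e m) : latV K r).
  rewrite -[X in supp_in _ X](subrK c); apply: supp_inD; last first.
    by move=> k kc /=; apply: contraTneq kc => ->; apply: Se.
  apply: supp_in_lspan span_c => x /= xs k kx /=.
  apply: contraNneq em => <-; apply/flattenP.
  by exists (enum_fset (msupp (x : {malg K[pbw r]}))) => //; apply: map_f.
by move=> /(_ (e m)); rewrite msupp_bvec in_fset1 eqxx /= eqxx => /(_ isT).
Qed.

End Support.

(** * Weights in a lattice VOA *)

Section Weight.
Context {r : nat} (G : 'M[int]_r).
Local Notation L := 'rV[int]_r.

Definition mset_wt (A : {mset 'I_r * nat}%mset) : nat :=
  (\sum_(x <- enum_mset A) x.2.+1)%N.

Lemma mset_wt0 : mset_wt mset0%mset = 0%N.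
Proof. by rewrite /mset_wt enum_mset0 big_nil. Qed.

Lemma mset_wtD1 x A : mset_wt (x +` A)%mset = (x.2.+1 + mset_wt A)%N.
Proof.
rewrite /mset_wt (perm_big (x :: enum_mset A)) ?big_cons //=.
apply/allP => a _ /=.
by rewrite count_mem_mset mset1DE (eq_sym a) -(count_mem_mset a A).
Qed.

Lemma wt_pbwE A (g : L) :
  wt_pbw G (A, g) = (mset_wt A)%:Z + (lform G g g %/ 2)%Z.
Proof. by []. Qed.

Lemma wt_pbw_ge (k : pbw r) : (lform G k.2 k.2 %/ 2)%Z <= wt_pbw G k.
Proof. by case: k => A g; rewrite wt_pbwE /=; lia. Qed.

Lemma lformDl (x y z : L) : lform G (x + y) z = lform G x z + lform G y z.
Proof. by rewrite /lform !mulmxDl mxE. Qed.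

Lemma lformDr (x y z : L) : lform G x (y + z) = lform G x y + lform G x z.
Proof. by rewrite /lform linearD mulmxDr mxE. Qed.

Lemma lformC : G^T = G -> forall x y : L, lform G x y = lform G y x.
Proof.
move=> Gsym x y; rewrite /lform.
have -> : y *m G *m x^T = (x *m G *m y^T)^T.
  by rewrite !trmx_mul trmxK Gsym mulmxA.
by rewrite [RHS]mxE.
Qed.

Definition bideg (k : pbw r) : int * L := (wt_pbw G k, k.2).

End Weight.

(** * Homogeneous operators *)

Section Homogeneous.
Context {K : fieldType} {r : nat} (G : 'M[int]_r).
Local Notation L := 'rV[int]_r.
Local Notation latV := (latV K r).
Implicit Types (A B : latV -> latV) (d : int * L).

(** Stated for all sets [T] of bidegrees rather than one bidegree at a time,
    so that it composes and applies to vectors that are not homogeneous. *)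
Definition homog d A : Prop := forall (T : set (int * L)) v,
  supp_in (fun k => T (bideg G k + d)) v ->
  supp_in (fun k => T (bideg G k)) (A v).

Lemma homog_id : homog 0 id.
Proof. by move=> T v Tv k /Tv; rewrite addr0. Qed.

Lemma homog_zero d : homog d (fun _ => 0).
Proof. by move=> T v _; apply: supp_in0. Qed.

Lemma homogD d A B : homog d A -> homog d B -> homog d (fun v => A v + B v).
Proof. by move=> hA hB T v Tv; apply: supp_inD; [apply: hA|apply: hB]. Qed.

Lemma homogZ d c A : homog d A -> homog d (fun v => c *: A v).
Proof. by move=> hA T v Tv; apply: supp_inZ; apply: hA. Qed.

Lemma homogN d A : homog d A -> homog d (fun v => - A v).
Proof.
by move=> hA T v Tv; rewrite -scaleN1r; apply: supp_inZ; apply: hA.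
Qed.

Lemma homog_sum d I (s : seq I) (A : I -> latV -> latV) :
  (forall i, homog d (A i)) -> homog d (fun v => \sum_(i <- s) A i v).
Proof. by move=> hA T v Tv; apply: supp_in_sum => i _; apply: hA. Qed.

(** A sum over the finite support of a family, whose value is 0 when that
    support is infinite, is homogeneous in either case. *)
Lemma homog_fsbig d (I : choiceType) (A : I -> latV -> latV) :
  (forall i, homog d (A i)) -> homog d (fun v => \sum_(i \in [set: I]) A i v).
Proof. by move=> hA T v Tv; apply: supp_in_sum => i _; apply: hA. Qed.

Lemma homog_comp d1 d2 A B :
  homog d1 A -> homog d2 B -> homog (d1 + d2) (fun v => A (B v)).
Proof.
move=> hA hB T v Tv; apply: (hA T).
apply: (hB (fun p => T (p + d1))) => k /Tv.
by rewrite -addrA (addrC d2).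
Qed.

Lemma homog_lext d (f : pbw r -> latV) :
  (forall k, supp_in [set k' | bideg G k' = bideg G k + d] (f k)) ->
  homog d (lext f).
Proof.
move=> hf T v Tv; apply: supp_in_lext Tv _ => k Tk k' /hf /= ->.
exact: Tk.
Qed.

Lemma homog_supp d A v p : homog d A ->
  supp_in [set k | bideg G k = p] v -> supp_in [set k | bideg G k = p + d] (A v).
Proof. by move=> hA hv; apply: (hA [set q | q = p + d]) => k /hv /= ->. Qed.

Lemma heis_homog (x : 'rV[K]_r) (m : int) : homog (- m, 0) (heis G x m).
Proof.
case: m => [[|n]|n]; apply: homog_lext => -[A g].
- by apply: supp_inZ; apply: supp_in_bvec; rewrite /= addr0.
- apply: supp_in_sum => j _ /=.
  have [jA|jA] := boolP ((j, n) \in (A : {mset 'I_r * nat}%mset)); last first.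
    by rewrite (mset_eq0P jA) mulr0 scale0r; apply: supp_in0.
  apply: supp_inZ; apply: supp_in_bvec; rewrite /bideg /=.
  congr pair; last by rewrite addr0.
  by rewrite !wt_pbwE -[in RHS](msetB1K jA) mset_wtD1 /=; set w := mset_wt _; lia.
apply: supp_in_sum => i _ /=; apply: supp_inZ; apply: supp_in_bvec.
rewrite /bideg /=.
congr pair; last by rewrite addr0.
by rewrite !wt_pbwE mset_wtD1 /= NegzE; lia.
Qed.

Definition homog_series (c : int) (A : @opser K latV) : Prop :=
  forall n : nat, homog (c * n%:Z, 0) (A n).

Lemma opser_one_homog c : homog_series c (@opser_one K latV).
Proof.
move=> n; rewrite /opser_one; case: eqP => [->|_]; last exact: homog_zero.
by rewrite mulr0; apply: homog_id.
Qed.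

Lemma opser_mul_homog c (A B : @opser K latV) :
  homog_series c A -> homog_series c B -> homog_series c (opser_mul A B).
Proof.
move=> hA hB n; apply: homog_sum => i.
have -> : (c * n%:Z, 0 : L) = (c * i%:Z, 0) + (c * (n - i)%N%:Z, 0).
  by congr pair; rewrite /= ?addr0 // -mulrDr -PoszD subnKC // -ltnS.
by apply: homog_comp.
Qed.

Lemma opser_exp_homog c (A : @opser K latV) : homog_series c A -> homog_series c (opser_exp A).
Proof.
move=> hA n; apply: homog_sum => k; apply: homogZ.
move: (nat_of_ord k) => j {k}; elim: j n => [|j IHj]; first exact: opser_one_homog.
by apply: opser_mul_homog.
Qed.

Lemma exp_creat_homog a : homog_series 1 (exp_creat (K := K) G a).
Proof.
apply: opser_exp_homog => n; case: eqP => [->|_]; first exact: homog_zero.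
by apply: homogZ; have := @heis_homog (lemb a) (- n%:Z); rewrite opprK mul1r.
Qed.

Lemma exp_annih_homog a : homog_series (-1) (exp_annih (K := K) G a).
Proof.
apply: opser_exp_homog => n; case: eqP => [->|_]; first exact: homog_zero.
by apply: homogN; apply: homogZ; rewrite mulN1r; apply: heis_homog.
Qed.

(** The modes of a vector of weight [h] and charge [g]: the mode of index [n]
    is the coefficient of z^{-n-1} and has weight h - n - 1. *)
Definition homog_field (d : int * L) (F : @field K latV) : Prop :=
  forall n : int, homog (d - (n + 1, 0)) (F n).

Lemma heis_field x : homog_field (1, 0) (heis G x).
Proof.
move=> n; have -> : (1, 0) - (n + 1, 0) = (- n, 0) :> (int * L).
  by congr pair; rewrite /= ?subr0 //; lia.
exact: (@heis_homog x n).
Qed.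

Lemma fderiv_field d F :
  homog_field d F -> homog_field (d + (1, 0)) (fderiv F).
Proof.
move=> hF n; apply: homogZ; have := hF (n - 1).
suff -> : d + (1, 0) - (n + 1, 0) = d - (n - 1 + 1, 0) by [].
by case: d {hF} => h g; congr pair; rewrite /= ?addr0 //; lia.
Qed.

Lemma fdivderiv_field d k F :
  homog_field d F -> homog_field (d + (k%:Z, 0)) (fdivderiv k F).
Proof.
move=> hF n; apply: homogZ; elim: k n => [|k IHk].
  by rewrite addr0.
have -> : d + (k.+1%:Z, 0) = d + (k%:Z, 0) + (1, 0).
  by rewrite -addrA; congr (_ + _); congr pair; rewrite /= ?addr0 //; lia.
exact: fderiv_field.
Qed.

Lemma nop_field d1 d2 (A B : @field K latV) :
  homog_field d1 A -> homog_field d2 B -> homog_field (d1 + d2) (nop A B).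
Proof.
case: d1 d2 => [h1 g1] [h2 g2] hA hB n.
apply: homogD; apply: homog_fsbig => j.
  have -> : (h1, g1) + (h2, g2) - (n + 1, 0) =
      ((h1, g1) - (Negz j + 1, 0)) + ((h2, g2) - (n + j%:Z + 1, 0)).
    by congr pair; rewrite /= ?subr0 // NegzE; lia.
  by apply: homog_comp.
have -> : (h1, g1) + (h2, g2) - (n + 1, 0) =
    ((h2, g2) - (n - j%:Z - 1 + 1, 0)) + ((h1, g1) - (j%:Z + 1, 0)).
  by congr pair; rewrite /= ?subr0; [lia|rewrite addrC].
by apply: homog_comp.
Qed.

Variable eps : L -> L -> int.
Hypothesis Gsym : G^T = G.
Hypothesis Geven : forall x : L, (2 %| lform G x x)%Z.

(** The coefficient of z^d in e_a z^a acts on charges b with (a|b) = d, for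
    which (a+b|a+b)/2 = (b|b)/2 + (a|a)/2 + d. *)
Lemma shift_z_homog a (d : int) :
  homog ((lform G a a %/ 2)%Z + d, a) (shift_z (K := K) G eps a d).
Proof.
apply: homog_lext => -[A b] /=; case: eqP => [abd|_]; last exact: supp_in0.
apply: supp_inZ; apply: supp_in_bvec; rewrite /bideg /=.
congr pair; last by rewrite addrC.
rewrite !wt_pbwE lformDl !lformDr abd (lformC Gsym b a) abd.
by have /dvdzP[p ->] := Geven a; have /dvdzP[q ->] := Geven b => /=; lia.
Qed.

(** In the coefficient of z^{-n-1} the powers z^p and z^{-q} of the two
    exponentials cancel against the exponent -n-1-p+q taken from e_a z^a, which
    leaves a weight independent of p and q. *)
Lemma Yexp_field a :
  homog_field ((lform G a a %/ 2)%Z, a) (Yexp (K := K) G eps a).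
Proof.
move=> n; apply: homog_fsbig => -[p q] /=.
have -> : ((lform G a a %/ 2)%Z, a) - (n + 1, 0) =
    (1 * p%:Z, 0) + ((-1 * q%:Z, 0) +
      ((lform G a a %/ 2)%Z + (- n - 1 - p%:Z + q%:Z), a)).
  by congr pair; rewrite /= ?subr0 ?add0r //; lia.
apply: homog_comp; first exact: exp_creat_homog.
by apply: homog_comp; [apply: exp_annih_homog|apply: shift_z_homog].
Qed.

(** A factor alpha_i(-n-1) enters as the field alpha_i(z), of weight 1,
    differentiated n times; the weight n + 1 it adds is that of the factor. *)
Lemma Ybasis_field k : homog_field (bideg G k) (Ybasis (K := K) G eps k).
Proof.
case: k => A g; rewrite /bideg /wt_pbw /Ybasis /=.
elim: (enum_mset A) => [|x s IHs] /=.
  by rewrite big_nil add0r; apply: Yexp_field.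
set d := (_, g) in IHs; rewrite big_cons.
have -> : ((x.2.+1 + \sum_(y <- s) y.2.+1)%N%:Z + (lform G g g %/ 2)%Z, g) =
    ((1, 0) + (x.2%:Z, 0)) + d.
  by congr pair; rewrite /= ?addr0 ?add0r //; lia.
by apply: nop_field => //; apply: fdivderiv_field; apply: heis_field.
Qed.

(** Supports are controlled by arbitrary sets of basis vectors, because the
    weight and charge of a_n b depend jointly on those of a and b. *)
Lemma latY_supp (P Q T : set (pbw r)) (a b : latV) (n : int) :
  supp_in P a -> supp_in Q b ->
  (forall k k1 k2, P k1 -> Q k2 ->
     bideg G k = bideg G k1 + bideg G k2 - (n + 1, 0) -> T k) ->
  supp_in T (latY G eps a n b).
Proof.
move=> Pa Qb PQT; apply: supp_in_lext Pa _ => k1 Pk1.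
pose T' p := exists2 k2, Q k2 & p = bideg G k1 + bideg G k2 - (n + 1, 0).
have TT' k : T' (bideg G k) -> T k by move=> [k2 Qk2]; apply: PQT.
suff YT' : supp_in (fun k => T' (bideg G k)) (Ybasis G eps k1 n b) by move=> k /YT' /TT'.
apply: (@Ybasis_field k1 n T' b) => k2 /Qb Qk2; exists k2 => //.
by rewrite addrA (addrC (bideg G k1)).
Qed.

(** * Bidegrees occurring in C_1 *)

Variable u : 'I_r -> 'rV[K]_r.
Let V := latticeVOA G eps u.

(** Weight 2 and charge 0 make L(-1), the mode of omega of index 0, raise the
    weight by 1 and preserve the charge. *)
Lemma omega_bideg :
  supp_in [set k | bideg G k = (2, 0)] (lat_omega G u).
Proof.
apply: supp_inZ; apply: supp_in_sum => i _.
have -> : (2, 0) = 0 + (- -1, 0) + (- -1, 0) :> (int * L).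
  by congr pair; rewrite /= !addr0.
have step p v : supp_in [set k | bideg G k = p] v ->
    supp_in [set k | bideg G k = p + (- -1, 0)] (heis G (u i) (-1) v).
  exact: (homog_supp (@heis_homog (u i) (-1))).
apply/step/step.
apply: supp_in_bvec; rewrite /= /bideg wt_pbwE mset_wt0 /=.
by congr pair; rewrite /lform mul0mx mul0mx mxE.
Qed.

Lemma Vplus_supp (M : set L) (v : V) : Vplus V (latsub M) v ->
  supp_in [set k | M k.2 /\ 1 <= wt_pbw G k] v.
Proof.
by apply: supp_in_lspan => w [Mw [n n1 wtw]] k kw; split; [apply: Mw|rewrite wtw].
Qed.

(** The two alternatives account for the two kinds of generators, a_{-1} b and
    L(-1) v. *)
Definition C1_bidegs (M : set L) : set (int * L) :=
  [set p | (exists k1 k2 : pbw r,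
     [/\ M k1.2, 1 <= wt_pbw G k1, M k2.2, 1 <= wt_pbw G k2 &
         p = bideg G k1 + bideg G k2]) \/
   (exists k : pbw r, p = bideg G k + (1, 0))].

Lemma C1_bideg (M : set L) (v : V) :
  C1space V (latsub M) v -> supp_in [set k | C1_bidegs M (bideg G k)] v.
Proof.
move=> [x xP [y yP <-]]; apply: supp_inD.
  apply: supp_in_lspan xP => _ [a [b [/Vplus_supp Va /Vplus_supp Vb ->]]].
  apply: latY_supp Va Vb _ => k k1 k2 [M1 w1] [M2 w2] /= kE.
  by left; exists k1, k2; split; rewrite // kE addNr subr0.
apply: supp_in_lspan yP => _ [w /Vplus_supp Vw <-].
apply: latY_supp omega_bideg Vw _ => k k1 k2 /= -> _ kE.
right; exists k2; rewrite kE addrAC addrC; congr (_ + _).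
by congr pair; rewrite /= ?subr0.
Qed.

End Homogeneous.

(** * The root lattice of type A_2 *)

Lemma A2_lformE (x y : 'rV[int]_2) :
  lform A2_gram x y =
  2 * (x 0 0 * y 0 0 + x 0 1 * y 0 1) - x 0 0 * y 0 1 - x 0 1 * y 0 0.
Proof.
rewrite /lform !mxE !big_ord_recl big_ord0 !mxE !big_ord_recl !big_ord0 !mxE /=.
have -> : lift ord0 ord0 = 1 :> 'I_2 by apply/val_inj.
by rewrite ?addr0; ring.
Qed.

Lemma A2_half_norm (x : 'rV[int]_2) :
  (lform A2_gram x x %/ 2)%Z = x 0 0 * x 0 0 - x 0 0 * x 0 1 + x 0 1 * x 0 1.
Proof. by rewrite A2_lformE; set p := x 0 0; set q := x 0 1; nia. Qed.

Lemma A2_sym : A2_gram^T = A2_gram.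
Proof. by apply/matrixP => i j; rewrite !mxE eq_sym. Qed.

Lemma A2_even (x : 'rV[int]_2) : (2 %| lform A2_gram x x)%Z.
Proof.
apply/dvdzP; exists (x 0 0 * x 0 0 - x 0 0 * x 0 1 + x 0 1 * x 0 1).
by rewrite A2_lformE; ring.
Qed.

Lemma A2_B_coord (x : 'rV[int]_2) :
  A2_B x -> 0 < x 0 1 \/ x 0 1 = 0 /\ 0 <= x 0 0.
Proof.
case=> [[m [n [n0 ->]]]|[k ->]]; [left|right].
  by rewrite !mxE -!scaler_int !mxE /=; lia.
by rewrite -scaler_nat !mxE /=; lia.
Qed.

(** The sign is essential: along these charges the norm increases with [m], so
    taking k alpha away from a charge with k > 0 raises the least weight. *)
Definition A2_ray (m : nat) : 'rV[int]_2 := A2_alpha *~ (- m%:Z) + A2_beta.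

Lemma A2_rayE m : (A2_ray m 0 0 = - m%:Z) * (A2_ray m 0 1 = 1).
Proof. by rewrite /A2_ray -!scaler_int !mxE /=; split; lia. Qed.

Lemma A2_ray_B m : A2_B (A2_ray m).
Proof. by left; exists (- m%:Z), 1. Qed.

Definition ray_key (m : nat) : pbw 2 := (mset0%mset, A2_ray m).

Lemma ray_key_inj : injective ray_key.
Proof.
move=> m n [] /(congr1 (fun x : 'rV[int]_2 => x 0 0)).
by rewrite !A2_rayE; lia.
Qed.

Lemma ray_key_wt m : wt_pbw A2_gram (ray_key m) = (m * m + m + 1)%N%:Z.
Proof. by rewrite wt_pbwE mset_wt0 A2_half_norm !A2_rayE; lia. Qed.

(** Among the two summands of the charge, one is k alpha with k >= 0 and
    the other is -(m + k) alpha + beta, whose half norm is at least that of the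
    sum; the first contributes weight at least 1. *)
Lemma A2_B_indecomposable m :
  ~ C1_bidegs A2_gram A2_B (bideg A2_gram (ray_key m)).
Proof.
case=> [[k1 [k2 [B1 w1 B2 w2 /pair_equal_spec[]]]]|[k /pair_equal_spec[]]] /=.
  rewrite ray_key_wt => wtE chE.
  have c0 := congr1 (fun x : 'rV[int]_2 => x 0 0) chE.
  have c1 := congr1 (fun x : 'rV[int]_2 => x 0 1) chE.
  have := wt_pbw_ge A2_gram k1; have := wt_pbw_ge A2_gram k2.
  rewrite /= !A2_rayE !mxE in c0 c1; rewrite !A2_half_norm.
  have := A2_B_coord B1; have := A2_B_coord B2.
  move: c0 c1 wtE w1 w2 {chE B1 B2}.
  set x1 := k1.2 0 0; set y1 := k1.2 0 1; set x2 := k2.2 0 0; set y2 := k2.2 0 1.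
  move: (wt_pbw _ k1) (wt_pbw _ k2) => p q c0 c1 wtE w1 w2 h2 h1.
  have [[Y1 [Y2 X1]]|[Y1 [Y2 X2]]] :
      y1 = 0 /\ y2 = 1 /\ 0 <= x1 \/ y1 = 1 /\ y2 = 0 /\ 0 <= x2 by lia.
    have X2 : x2 = - m%:Z - x1 by lia.
    have : 0 <= m%:Z * x1 by rewrite mulr_ge0.
    by move: h1 h2 wtE; rewrite Y1 Y2 X2; nia.
  have X1 : x1 = - m%:Z - x2 by lia.
  have : 0 <= m%:Z * x2 by rewrite mulr_ge0.
  by move: h1 h2 wtE; rewrite Y1 Y2 X1; nia.
rewrite ray_key_wt => wtE; rewrite addr0 => chE.
have := wt_pbw_ge A2_gram k; rewrite -chE A2_half_norm !A2_rayE.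
by move: (wt_pbw _ k) wtE => p; lia.
Qed.

Theorem proposition5p7 (R : realType)
    (eps : 'rV[int]_2 -> 'rV[int]_2 -> int) (heps : is_cocycle A2_gram eps)
    (u : 'I_2 -> 'rV[R[i]]_2) (hu : orthonormal_basis A2_gram u) :
  ~ C1_cofinite (latticeVOA A2_gram eps u) (latsub A2_B).
Proof.
apply: (infinite_codim ray_key_inj) => [m|v m Sv].
  by apply: supp_in_bvec; apply: A2_ray_B.
apply/negP => /(C1_bideg A2_sym A2_even Sv).
exact: A2_B_indecomposable.
Qed.
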